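(* Let $\mathcal{S}$ be a finite set of solvers and $\mathcal{P}$ a finite set of test problems, with $|\mathcal{S}|\ge 2$ and $|\mathcal{P}|\ge 1$, and let $\{Q_s(\tau)\}_{s\in\mathcal{S}}$, $\tau\in[0,1]$, be the associated weak quality profiles. Weak quality profiles are invariant under any consistent affine transformation of the objective functions. That is, suppose that for each $p\in\mathcal{P}$ the objective function $f^{(p)}$ is replaced by $a_p f^{(p)}+b_p$ with $a_p>0$ and $b_p\in\mathbb{R}$, so that $f^{(p)}(x_0^{(p)})$ is replaced by $a_p f^{(p)}(x_0^{(p)})+b_p$, each $f_s^{(p)}(x^\ast)$ is replaced by $a_p f_s^{(p)}(x^\ast)+b_p$, and hence $f_L^{(p)}$ is replaced by $a_p f_L^{(p)}+b_p$. Then for every $s\in\mathcal{S}$ and every $\tau\in[0,1]$ the value $Q_s(\tau)$ computed from the transformed data equals the value $Q_s(\tau)$ computed from the original data.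
   Context: For each test problem $p\in\mathcal{P}$, $f^{(p)}$ is its real-valued objective function (to be minimized) and $x_0^{(p)}$ is the starting point common to all solvers. For $s\in\mathcal{S}$, $f_s^{(p)}(x^\ast)\in\mathbb{R}$ denotes the value of $f^{(p)}$ at the best point $x^\ast$ found by solver $s$ on problem $p$ (the dependence of $x^\ast$ on $s$ and $p$ is suppressed). The reference value is $f_L^{(p)}=\min_{s\in\mathcal{S}} f_s^{(p)}(x^\ast)$. It is assumed that $f_s^{(p)}(x^\ast)\le f^{(p)}(x_0^{(p)})$ for all $s\in\mathcal{S}$, $p\in\mathcal{P}$. For $\tau\ge 0$, $$Q_s(\tau)=\frac{1}{|\mathcal{P}|}\,\Bigl|\bigl\{p\in\mathcal{P} : f_s^{(p)}(x^\ast)-f_L^{(p)}\le \tau\,[\,f^{(p)}(x_0^{(p)})-f_L^{(p)}\,]\bigr\}\Bigr|.$$ The weak quality profiles are the (plots of the) functions $Q_s$, $s\in\mathcal{S}$, on $[0,1]$. An affine transformation $t\mapsto at+b$ is called consistent if $a>0$, $b\in\mathbb{R}$. The points found by the solvers are regarded as fixed under the transformation. *)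

(* Defs.v *)
From HB Require Import structures.
From mathcomp Require Import all_boot all_order all_algebra.
From mathcomp Require Import reals.

Set Implicit Arguments.
Unset Strict Implicit.
Unset Printing Implicit Defensive.

Import Order.TTheory GRing.Theory Num.Theory.
Local Open Scope ring_scope.

(* The big operator needs a default value: it is taken among the values of F
   themselves, so that the result is min_s F s.  The value 0 is only returned
   when S is empty. *)
Definition finmin (R : realType) (S : finType) (F : S -> R) : R :=
  if [pick s : S] is Some s0 then \big[Num.min/F s0]_(s : S) F s else 0.

Lemma finmin_le (R : realType) (S : finType) (F : S -> R) (s : S) :
  finmin F <= F s.
Proof.
rewrite /finmin; case: pickP => [s0 _|/(_ s)//].
exact: bigmin_le_cond.
Qed.

Lemma finmin_attained (R : realType) (S : finType) (F : S -> R) :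
  (0 < #|S|)%N -> exists s : S, finmin F = F s.
Proof.
case/card_gt0P=> s1 _; rewrite /finmin; case: pickP => [s0 _|/(_ s1)//].
elim/big_ind: _ => [|x y [s ->] [t ->]|s _]; [by exists s0| |by exists s].
by case: (leP (F s) (F t)) => _; [exists s|exists t].
Qed.

(* Problem p has objective f p on its own domain X p, starting point x0 p, and
   xbest s p is the best point found on p by solver s. *)

Definition f_L (R : realType) (S P : finType) (X : P -> Type)
    (f : forall p, X p -> R) (xbest : S -> forall p, X p) (p : P) : R :=
  finmin (fun s => f p (xbest s p)).

Definition weak_quality_profile (R : realType) (S P : finType) (X : P -> Type)
    (f : forall p, X p -> R) (x0 : forall p, X p) (xbest : S -> forall p, X p)
    (s : S) (tau : R) : R :=
  (#|P|%:R)^-1 *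
  #|[set p : P | f p (xbest s p) - f_L f xbest p
                   <= tau * (f p (x0 p) - f_L f xbest p)]|%:R.

Definition affine_transform (R : realType) (P : finType) (X : P -> Type)
    (a b : P -> R) (f : forall p, X p -> R) : forall p, X p -> R :=
  fun p x => a p * f p x + b p.

(* Main.v *)
Require Import Defs.
From mathcomp Require Import all_boot all_order all_algebra.
From mathcomp Require Import reals.

Set Implicit Arguments.
Unset Strict Implicit.
Unset Printing Implicit Defensive.

Import Order.TTheory GRing.Theory Num.Theory.
Local Open Scope ring_scope.

(** The map t |-> a * t + b with a > 0 is increasing, so it commutes with the
    minimum over a nonempty finite set ([finmin_affine]); hence the reference
    value undergoes the same transformation as the objective.  In the
    inequality that decides whether a problem is counted, only differences of
    transformed values occur: the shifts b cancel and both sides acquire the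
    same factor a > 0 ([le_affine_gap]).  So each profile counts the same
    problems before and after the transformation. *)

(** Both inequalities come from the characterization of a minimum as an attained
    lower bound: each side is a value of its family, which bounds the minimum of
    that family from above.  Nonemptiness is essential, since the minimum over
    an empty index type is 0 by convention, and that is not shifted by [b]. *)
Lemma finmin_affine (R : realType) (S : finType) (F : S -> R) (a b : R) :
  (0 < #|S|)%N -> 0 < a -> finmin (fun s => a * F s + b) = a * finmin F + b.
Proof.
move=> S_gt0 a_gt0; apply/eqP; rewrite eq_le; apply/andP; split.
  have [s ->] := finmin_attained F S_gt0.
  exact: (finmin_le (fun s => a * F s + b)).
have [s ->] := finmin_attained (fun s => a * F s + b) S_gt0.
by rewrite lerD2r ler_pM2l // finmin_le.
Qed.

Lemma le_affine_gap (R : realDomainType) (a b tau u v w : R) :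
  0 < a ->
  ((a * u + b) - (a * v + b) <= tau * ((a * w + b) - (a * v + b)))
    = (u - v <= tau * (w - v)).
Proof.
move=> a_gt0.
have diffE x y : (a * x + b) - (a * y + b) = a * (x - y).
  by rewrite opprD addrACA subrr addr0 mulrBr.
by rewrite !diffE mulrCA ler_pM2l.
Qed.

Theorem lemma2p2 (R : realType) (S P : finType)
    (hS : (2 <= #|S|)%N) (hP : (1 <= #|P|)%N)
    (X : P -> Type) (f : forall p : P, X p -> R)
    (x0 : forall p : P, X p) (xbest : S -> forall p : P, X p)
    (hx0 : forall (s : S) (p : P), f p (xbest s p) <= f p (x0 p))
    (a b : P -> R) (ha : forall p : P, 0 < a p) :
  (forall p : P,
     f_L (affine_transform a b f) xbest p = a p * f_L f xbest p + b p) /\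
  (forall (s : S) (tau : R), 0 <= tau <= 1 ->
     weak_quality_profile (affine_transform a b f) x0 xbest s tau
       = weak_quality_profile f x0 xbest s tau).
Proof.
have fLE p : f_L (affine_transform a b f) xbest p = a p * f_L f xbest p + b p.
  by apply: finmin_affine (ha p); apply: ltnW.
split=> // s tau _; rewrite /weak_quality_profile.
congr (_ * #|pred_of_set _|%:R); apply/setP=> p.
by rewrite !inE fLE le_affine_gap.
Qed.
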